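(* Let $\alpha\in[0,1]$ and let $T$ be a mixed tree of order $n$ and size $m$. Then $$\rho_\alpha(T)\leq\frac{1}{2}\left(\alpha n+\sqrt{\alpha^2n^2-4\alpha^2(n-1)+4(1-\alpha)^2(m-n+1)}\right).$$ Moreover, every mixed star of order $n$ and size $m$ whose maximum out-degree is $n-1$ attains this upper bound.
   Context: A mixed graph $G$ on vertex set $[n]=\{1,\dots,n\}$ is a graph in which between two distinct vertices there is at most one of: a directed arc $\vec{ij}$, an undirected edge $ij$, or nothing. Its size is the number of arcs plus twice the number of undirected edges. Its adjacency matrix $A=(a_{ij})$ is the $n\times n$ $0/1$ matrix with $a_{ij}=1$ iff $\vec{ij}\in E(G)$ or $ij\in E(G)$. The out-degree of $i$ is $d^+_i=|\{j: \vec{ij}\in E(G)\text{ or } ij\in E(G)\}|$ and $D^+=\mathrm{diag}(d^+_1,\dots,d^+_n)$. For $\alpha\in[0,1]$, $A_\alpha(G)=\alpha D^++(1-\alpha)A$, and $\rho_\alpha(G)$ is the largest real eigenvalue of $A_\alpha(G)$. The underlying graph of $G$ is obtained by forgetting the directions of arcs. A mixed tree (resp. mixed star) is a mixed graph whose underlying graph is a tree (resp. a star, i.e. a tree of diameter at most $2$).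
   Formalization: The claim that mixed stars attain the bound is stated for order n at least 2; for n = 1 (single vertex, m = 0, maximum out-degree 0 = n-1) it fails when α > 0, since the spectral radius is 0 while the bound equals α. *)

(* Defs.v *)
From mathcomp Require Import all_boot all_order all_algebra.
From mathcomp Require Import reals.

Set Implicit Arguments.
Unset Strict Implicit.
Unset Printing Implicit Defensive.

Import Order.TTheory GRing.Theory Num.Theory.
Local Open Scope ring_scope.

(* [arc_excl] at [i = j] also rules out directed loops. *)
Record mixedGraph (n : nat) := MixedGraph {
  arc : rel 'I_n;
  edge : rel 'I_n;
  edge_sym : symmetric edge;
  edge_irr : irreflexive edge;
  arc_excl : forall i j, arc i j -> ~~ arc j i && ~~ edge i j
}.

Section MixedGraph.
Variables (n : nat) (G : mixedGraph n).

(* [edge G] is a symmetric relation, so each undirected edge is counted once,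
   as the pair [(i, j)] with [i < j]. *)
Definition mixed_size : nat :=
  (#|[set p : 'I_n * 'I_n | arc G p.1 p.2]|
   + 2 * #|[set p : 'I_n * 'I_n | edge G p.1 p.2 & (p.1 < p.2)%N]|)%N.

Definition adj : rel 'I_n := [rel i j | arc G i j || edge G i j].

Definition outdeg (i : 'I_n) : nat := #|[set j | adj i j]|.

Definition max_outdeg : nat := \max_(i < n) outdeg i.

Definition underlying : rel 'I_n :=
  [rel i j | [|| arc G i j, arc G j i | edge G i j]].

(* Cycles of a simple graph have at least 3 vertices; [ucycle] alone also
   accepts [:: i; j] for any edge [ij]. *)
Definition mixed_tree : Prop :=
  [/\ (0 < n)%N,
      forall i j, connect underlying i j
    & forall c : seq 'I_n, (2 < size c)%N -> ~ ucycle underlying c].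

Definition diameter_le (d : nat) : Prop :=
  forall i j : 'I_n, exists p : seq 'I_n,
    [/\ path underlying i p, last i p = j & (size p <= d)%N].

Definition mixed_star : Prop := mixed_tree /\ diameter_le 2.

Variable R : realType.

Definition adj_mx : 'M[R]_n := \matrix_(i, j) (adj i j)%:R.

Definition outdeg_mx : 'M[R]_n := diag_mx (\row_i (outdeg i)%:R).

Definition A_alpha (alpha : R) : 'M[R]_n :=
  alpha *: outdeg_mx + (1 - alpha) *: adj_mx.

(* [is_rho alpha r] : r is the (necessarily unique) largest real eigenvalue. *)
Definition is_rho (alpha r : R) : Prop :=
  eigenvalue (A_alpha alpha) r
  /\ forall x : R, eigenvalue (A_alpha alpha) x -> x <= r.

End MixedGraph.

Definition rho_bound (R : realType) (alpha : R) (n m : nat) : R :=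
  2^-1 * (alpha * n%:R
    + Num.sqrt (alpha ^+ 2 * n%:R ^+ 2 - 4 * alpha ^+ 2 * (n%:R - 1)
                + 4 * (1 - alpha) ^+ 2 * (m%:R - n%:R + 1))).

(* Main.v *)
(** Since the only directed cycles of a mixed tree are its undirected edges,
    deleting all arcs (but keeping the diagonal) does not change the
    characteristic polynomial of [A_alpha], and leaves a real symmetric matrix
    supported on a forest; this gives a real eigenvalue.  Let [x] be an
    eigenvalue, [u] the number of undirected edges and suppose [x] exceeds the
    bound.  The ends of an edge have out-degrees at least 1 with sum at most
    [n], so [(x - alpha d_i) (x - alpha d_j)] is at least
    [K = (x - alpha) (x - alpha (n - 1))] on every edge.  The forest being
    bipartite, Cauchy-Schwarz over its edges gives [K <= (1 - alpha)^2 u].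
    Connectedness gives [u <= m - n + 1], and the bound is the larger root of
    [(x - alpha) (x - alpha (n - 1)) = (1 - alpha)^2 (m - n + 1)]. *)
Require Import Defs.
From mathcomp Require Import all_boot all_order all_algebra.
From mathcomp Require Import reals perm complex polyrcf ring lra zify.

Set Implicit Arguments.
Unset Strict Implicit.
Unset Printing Implicit Defensive.

Import Order.TTheory GRing.Theory Num.Theory.
Local Open Scope ring_scope.

(** * Acyclic and connected relations on finite types *)

(** A duplicate-free [e']-path from [x] to [y] would be closed by [e y x] into an [e]-cycle, which
    has at least three vertices because [x != y] and [e' x y] fails. *)
Lemma not_connect_last (T : finType) (e e' : rel T) (x y : T) :
  subrel e' e -> (forall c, (2 < size c)%N -> ~ ucycle e c) ->
  e y x -> x != y -> ~~ e' x y -> ~~ connect e' x y.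
Proof.
move=> sub acyc eyx xy ne'; apply/negP => /connectP[p].
case/shortenP => p' pth uni _ lst.
case: p' => [|z [|w p']] in pth uni lst *.
- by rewrite lst eqxx in xy.
- by case/andP: pth => + _; rewrite /= in lst; rewrite -lst (negbTE ne').
- apply: (acyc [:: x, z, w & p']) => //.
  apply/andP; split=> //; rewrite /cycle rcons_path (sub_path sub pth) /=.
  by rewrite /= in lst; rewrite -lst.
Qed.

(** Induction on the number of related pairs: once the edge [xy] is deleted, [x] and [y] lie in
    different components, so the colours on one of them can be flipped freely. *)
Lemma acyclic_bicoloring (T : finType) (e : rel T) :
  symmetric e -> irreflexive e ->
  (forall c, (2 < size c)%N -> ~ ucycle e c) ->
  exists f : T -> bool, forall x y, e x y -> f x != f y.
Proof.
have [k] := ubnP #|[set p : T * T | e p.1 p.2]|.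
elim: k e => // k IH e; rewrite ltnS => lek sym irr acyc.
case: (pickP [pred p : T * T | e p.1 p.2]) => [[x y] /= exy|no]; last first.
  by exists (fun=> true) => a b eab; have := no (a, b); rewrite /= eab.
pose e' := [rel a b | [&& e a b, (a, b) != (x, y) & (a, b) != (y, x)]].
have sub : subrel e' e by move=> a b /and3P[].
have sym' : symmetric e'.
  move=> a b /=; rewrite sym; congr (_ && _); rewrite andbC !xpair_eqE.
  by congr (~~ _ && ~~ _); rewrite andbC.
have xy : x != y by apply: contraTneq exy => ->; rewrite irr.
have nc : ~~ connect e' x y.
  by apply: (@not_connect_last _ e) => //=; rewrite 1?sym ?eqxx ?andbF.
have [||a||f Pf] := IH e'.
- apply: leq_trans lek; apply: proper_card; apply/properP; split.
    by apply/subsetP => p; rewrite !inE => /sub.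
  by exists (x, y); rewrite !inE /= ?eqxx ?andbF.
- exact: sym'.
- by rewrite /= irr.
- move=> c c2 /andP[cyc uni]; apply: (acyc c c2); rewrite /ucycle uni andbT.
  by case: c cyc {c2 uni} => //= z c; apply: sub_path.
have csym := sym_connect_sym sym'.
(* The component of [y] is flipped only if [x] and [y] received the same colour; every remaining
   edge stays inside one component. *)
exists (fun z => f z (+) (connect e' y z && (f x == f y))) => a b eab.
case e'ab : (e' a b).
  rewrite (same_connect_r csym (@connect1 _ e' _ _ e'ab)).
  by have := Pf _ _ e'ab; case: (f a) (f b) (_ && _) => [] [] [].
have nc' : connect e' y x = false by rewrite csym (negbTE nc).
have := e'ab; rewrite /= eab /= => /negbT; rewrite negb_and !negbK.
by case/orP => /eqP[-> ->]; rewrite connect0 nc' /=; case: (f x) (f y) => [] [].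
Qed.

(** A vertex set [S] is grown one vertex at a time; connectedness gives an edge leaving [S], and
    this edge contributes a new member of [F]. One orientation per edge in [F] suffices. *)
Lemma connected_card_edges (T : finType) (F : {set T * T}) (e : rel T) :
  (forall x y, e x y -> ((x, y) \in F) || ((y, x) \in F)) ->
  (forall x y, connect e x y) -> (#|T|.-1 <= #|F|)%N.
Proof.
move=> eF conn.
have grow k : (k < #|T|)%N ->
    exists2 S : {set T}, #|S| = k.+1 & (k <= #|F :&: setX S S|)%N.
  elim: k => [/card_gt0P[x _]|k IH ltk]; first by exists [set x]; rewrite ?cards1.
  have [S cS leS] := IH (ltnW ltk).
  have /card_gt0P[x xS] : (0 < #|S|)%N by rewrite cS.
  have [z zS] : exists z, z \notin S.
    have /card_gt0P[z] : (0 < #|~: S|)%N by rewrite cardsCs setCK cS subn_gt0.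
    by rewrite inE; exists z.
  have [/existsP[a /existsP[b /and3P[aS bS eab]]]|no] :=
    boolP [exists a, exists b, [&& a \in S, b \notin S & e a b]]; last first.
    suff cl w p : w \in S -> path e w p -> last w p \in S.
      have /connectP[p pth lst] := conn x z.
      by move: zS; rewrite lst (cl _ _ xS pth).
    elim: p w => //= b p IHp w wS /andP[ewb]; apply: IHp.
    apply: contraNT no => bS; apply/existsP; exists w; apply/existsP; exists b.
    by rewrite wS bS.
  have [q qF /andP[qS1 qS2]] : exists2 q, q \in F & (q \notin setX S S) &&
      (q \in setX (b |: S) (b |: S)).
    case/orP: (eF _ _ eab) => qF; [exists (a, b)|exists (b, a)] => //;
    by rewrite !inE /= (negbTE bS) aS eqxx ?orbT ?andbF.
  exists (b |: S); first by rewrite cardsU1 bS cS.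
  apply: leq_ltn_trans leS _; apply: proper_card; apply/properP; split.
    by apply/setIS/setXS; apply: subsetUr.
  by exists q; rewrite !in_setI ?qF // (negbTE qS1).
case cT : #|T| => [|k] //=.
by have [|S _ le] := grow k; rewrite ?cT //; apply: leq_trans le (subset_leq_card (subsetIl _ _)).
Qed.

(** * Determinants, real eigenvalues and an eigenvector estimate *)

(* In the Leibniz expansion a permutation either preserves every level set of
   [h] or raises the level somewhere. *)
Lemma det_level_eq (R : comNzRingType) (n : nat) (A B : 'M[R]_n)
    (h : 'I_n -> nat) :
  (forall i j, h i = h j -> A i j = B i j) ->
  (forall i j, (h i < h j)%N -> A i j = 0 /\ B i j = 0) ->
  \det A = \det B.
Proof.
move=> eqAB zeroAB; apply: eq_bigr => s _; congr (_ * _).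
have [/existsP[i lti]|/existsPn no] := boolP [exists i, (h i < h (s i))%N].
  have [A0 B0] := zeroAB _ _ lti.
  by rewrite (bigD1 i) //= A0 mul0r (bigD1 i) //= B0 mul0r.
apply: eq_bigr => i _; apply: eqAB; apply/eqP.
have les j : (h (s j) <= h j ?= iff (h j == h (s j)))%N.
  by split; [rewrite leqNgt no | rewrite eq_sym].
(* Both sides have the same sum, as [s] permutes the indices, so every inequality [h (s j) <= h j]
   is an equality. *)
have /leqif_sum [_] := fun j (_ : xpredT j) => les j.
rewrite [X in _ == X](reindex_inj (@perm_inj _ s)) eqxx => /esym/forallP.
exact.
Qed.

(** The complex closure [R[i]] supplies an eigenvalue [z] with eigenvector [v]; the Hermitian form
    [v M v^*] equals [z * N] with [N] the squared norm, and both it and [N] are self-conjugate, so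
    [z] is real. *)
Lemma symmetric_eigenvalue (R : rcfType) (n : nat) (M : 'M[R]_n) :
  (0 < n)%N -> M^T = M -> exists x, eigenvalue M x.
Proof.
move=> n0 symM; pose toC := real_complex R.
have [z rz] : exists z, root (char_poly (map_mx toC M)) z.
  by apply: closed_rootP; rewrite size_char_poly; case: n n0 {M symM}.
have /eigenvalueP[v vM v0] : eigenvalue (map_mx toC M) z by rewrite eigenvalue_root_char.
pose N := \sum_i v 0 i * (v 0 i)^*.
have N0 : N != 0.
  apply: contra v0; rewrite /N psumr_eq0 => [/allP all0|i _]; last exact: mul_conjC_ge0.
  apply/eqP/rowP => i; rewrite mxE; apply/eqP.
  by have := all0 i (mem_index_enum _); rewrite /= mul_conjC_eq0.
have E j : z * v 0 j = \sum_i v 0 i * toC (M i j).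
  move/rowP/(_ j): vM; rewrite !mxE => <-; by apply: eq_bigr => i _; rewrite mxE.
have zN : z * N = \sum_j \sum_i v 0 i * toC (M i j) * (v 0 j)^*.
  by rewrite mulr_sumr; apply: eq_bigr => j _; rewrite mulrA E mulr_suml.
have NR : N^* = N.
  by rewrite rmorph_sum; apply: eq_bigr => i _; rewrite rmorphM /= conjCK mulrC.
have zR : z^* = z.
  apply: (mulIf N0); rewrite -{1}NR -rmorphM zN [RHS]exchange_big rmorph_sum /=.
  apply: eq_bigr => i _; rewrite rmorph_sum; apply: eq_bigr => j _ /=.
  rewrite !rmorphM /= conjCK -{1}symM mxE.
  have -> : (toC (M i j))^* = toC (M i j) by exact: conjc_real.
  ring.
have [x zx] : exists x, z = toC x.
  case: z zR {rz vM E zN} => a b [] /eqP; rewrite eqNr => /eqP ->; by exists a.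
exists x; rewrite eigenvalue_root_char.
by move: rz; rewrite zx -map_char_poly fmorph_root.
Qed.

(* Both colour classes carry the same energy [a]; AM-GM applied to each edge
   term [2 a K beta v_i v_j] then compares [a ^+ 2 * K] with
   [a ^+ 2 * beta ^+ 2] times the number of edges. *)
Lemma bicolored_eigenvector_bound (R : realFieldType) (n : nat) (e : rel 'I_n)
    (f : pred 'I_n) (D v : 'I_n -> R) (beta K : R) :
  symmetric e -> (forall i j, e i j -> f i != f j) ->
  (forall i, 0 < D i) -> 0 < K -> (forall i j, e i j -> K <= D i * D j) ->
  (forall j, D j * v j = beta * \sum_i (e i j)%:R * v i) ->
  (exists i, v i != 0) ->
  K <= beta ^+ 2 * #|[set p | e p.1 p.2 & f p.1 && ~~ f p.2]|%:R.
Proof.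
move=> sym fP D0 K0 DK eig [k vk].
pose a := \sum_(i | f i) D i * v i ^+ 2.
pose b := \sum_(i | ~~ f i) D i * v i ^+ 2.
pose X := \sum_(i | f i) \sum_(j | ~~ f j) (e i j)%:R * (v i * v j).
have aX : a = beta * X.
  rewrite mulr_sumr; apply: eq_bigr => i fi.
  rewrite expr2 mulrA eig -mulrA mulr_suml; congr (_ * _).
  rewrite [LHS](bigID f) /= big1 ?add0r => [|j fj].
    by apply: eq_bigr => j _; rewrite sym; ring.
  by case eji : (e j i); [have := fP _ _ eji; rewrite fi fj | rewrite !mul0r].
have bX : b = beta * X.
  rewrite /X exchange_big mulr_sumr; apply: eq_bigr => i fi.
  rewrite expr2 mulrA eig -mulrA mulr_suml; congr (_ * _).
  rewrite [LHS](bigID f) /= [X in _ + X]big1 ?addr0 => [|j fj].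
    by apply: eq_bigr => j _; ring.
  case eji : (e j i); last by rewrite !mul0r.
  by have := fP _ _ eji; rewrite (negbTE fi) (negbTE fj).
have a0 : 0 < a.
  (* The sum of the two energies is positive since [v] is nonzero, and [a = b]. *)
  have : 0 < a + b.
    rewrite /a /b -(bigID f xpredT (fun i => D i * v i ^+ 2)) /=.
    rewrite (bigD1 k) //= ltr_pwDl //.
      by rewrite mulr_gt0 // lt0r sqrf_eq0 vk sqr_ge0.
    by apply: sumr_ge0 => i _; rewrite mulr_ge0 ?sqr_ge0 // ltW.
  rewrite bX -aX; lra.
have term i j : 2 * a * K * (beta * ((e i j)%:R * (v i * v j))) <=
    a ^+ 2 * beta ^+ 2 * (e i j)%:R + K * (D i * v i ^+ 2 * (D j * v j ^+ 2)).
  case eij : (e i j); last first.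
    rewrite mul0r !mulr0 add0r mulr_ge0 ?(ltW K0) //.
    by apply: mulr_ge0; rewrite mulr_ge0 ?sqr_ge0 // ltW.
  have : 0 <= (D i * D j - K) * (K * (v i * v j) ^+ 2).
    by rewrite mulr_ge0 ?subr_ge0 ?DK // mulr_ge0 ?sqr_ge0 // ltW.
  have := sqr_ge0 (a * beta - K * (v i * v j)).
  rewrite /=; lra.
pose u : R := \sum_(i | f i) \sum_(j | ~~ f j) (e i j)%:R.
have -> : #|[set p | e p.1 p.2 & f p.1 && ~~ f p.2]|%:R = u.
  rewrite /u pair_big /= -sum1_card natr_sum.
  rewrite [LHS]big_mkcond [RHS]big_mkcond /=; apply: eq_bigr => p _.
  by rewrite inE; case: (e _ _) (f _) (f _) => [] [] [].
have : 2 * a * K * (beta * X) <= a ^+ 2 * beta ^+ 2 * u + K * (a * b).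
  have -> : a * b = \sum_(i | f i) \sum_(j | ~~ f j)
      (D i * v i ^+ 2 * (D j * v j ^+ 2)).
    by rewrite mulr_suml; apply: eq_bigr => i _; rewrite mulr_sumr.
  clearbody a; rewrite /X /u !mulr_sumr -big_split /=; apply: ler_sum => i _.
  rewrite !mulr_sumr -big_split /=; apply: ler_sum => j _.
  exact: term.
(* With [beta * X = a = b] the summed inequality reads [2 a^2 K <= a^2 beta^2 u + K a^2]. *)
rewrite -aX bX -aX => le.
have : a ^+ 2 * K <= a ^+ 2 * (beta ^+ 2 * u) by lra.
by rewrite ler_pM2l // exprn_gt0.
Qed.

(** * Orientation counts and the quadratic equation of the bound *)

(** Swapping coordinates exchanges the related pairs in [Q] with those outside [Q]. This lets edges
    oriented by colour be compared with edges oriented by index. *)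
Lemma card_oriented_edges (T : finType) (e Q : rel T) :
  symmetric e -> (forall x y, e x y -> Q x y (+) Q y x) ->
  (2 * #|[set p | e p.1 p.2 & Q p.1 p.2]|)%N = #|[set p | e p.1 p.2]|.
Proof.
move=> sym PQ; set A := [set p | _ & _]; set E := [set p | _].
rewrite -(cardsID A E) mul2n -addnn; congr (_ + _)%N.
  by apply: eq_card => p; rewrite !inE; case: (e _ _).
pose sw (p : T * T) := (p.2, p.1).
have swK : involutive sw by case.
rewrite -(card_imset _ (inv_inj swK)); apply: eq_card => p.
rewrite -[p in LHS]swK (mem_imset _ _ (inv_inj swK)) !inE /= sym.
case epq : (e p.1 p.2) => //=.
by have := PQ _ _ epq; case: (Q _ _) (Q _ _) => [] [].
Qed.

Lemma rho_bound_quadratic (R : realType) (alpha : R) (n m : nat) :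
  (0 < n)%N -> (n <= m.+1)%N -> 0 <= alpha ->
  let r := rho_bound alpha n m in
  [/\ (r - alpha) * (r - alpha * (n%:R - 1))
        = (1 - alpha) ^+ 2 * (m%:R - n%:R + 1),
      alpha <= r & alpha * (n%:R - 1) <= r].
Proof.
move=> n0 nm a0 r.
have nm' : 0 <= (m%:R - n%:R + 1 : R) by move: nm; rewrite -(ler_nat R) -natr1; lra.
have n1 : 1 <= n%:R :> R by rewrite ler1n.
rewrite /r /rho_bound; set d := alpha ^+ 2 * _ - _ + _.
have dE : d = (alpha * (n%:R - 2)) ^+ 2
    + 4 * ((1 - alpha) ^+ 2 * (m%:R - n%:R + 1)) by rewrite /d; ring.
have c0 : 0 <= (1 - alpha) ^+ 2 * (m%:R - n%:R + 1) by rewrite mulr_ge0 ?sqr_ge0.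
have led : (alpha * (n%:R - 2)) ^+ 2 <= d by rewrite dE; lra.
have d0 : 0 <= d by apply: le_trans led; apply: sqr_ge0.
have sE : Num.sqrt d ^+ 2 = d by rewrite sqr_sqrtr.
(* Both signs are needed: [alpha * n / 2] plus or minus [alpha * (n - 2) / 2] gives
   [alpha * (n - 1)] and [alpha]. *)
have /(le_trans (ler_norm _)) : `|alpha * (n%:R - 2)| <= Num.sqrt d.
  by rewrite -sqrtr_sqr ler_wsqrtr.
have : - (alpha * (n%:R - 2)) <= Num.sqrt d.
  rewrite (le_trans _ (_ : `|alpha * (n%:R - 2)| <= _)) //.
    by rewrite -normrN ler_norm.
  by rewrite -sqrtr_sqr ler_wsqrtr.
move: sE; set s := Num.sqrt d => sE le1 le2; split; [|lra|lra].
move: sE; rewrite dE; move: (m%:R : R) (n%:R : R) => x y sE.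
lra.
Qed.

(** * Combinatorics of mixed trees *)

Section MixedTree.
Variables (n : nat) (G : mixedGraph n).

Lemma underlying_sym : symmetric (underlying G).
Proof. by move=> i j; rewrite /underlying /= orbCA edge_sym. Qed.

Lemma underlying_irr : irreflexive (underlying G).
Proof.
move=> i; rewrite /underlying /= edge_irr orbF orbb; apply/negP => aii.
by have := arc_excl aii; rewrite aii.
Qed.

Lemma adj_underlying : subrel (adj G) (underlying G).
Proof. by move=> i j; rewrite /underlying /= => /orP[] ->; rewrite ?orbT. Qed.

Lemma edge_underlying : subrel (edge G) (underlying G).
Proof. by move=> i j ij; rewrite /underlying /= ij !orbT. Qed.

Lemma edge_adj : subrel (edge G) (adj G).
Proof. by move=> i j ij; rewrite /adj /= ij orbT. Qed.

Lemma outdegE (i : 'I_n) : outdeg G i = (\sum_j adj G i j)%N.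
Proof.
by rewrite /outdeg -sum1_card big_mkcond; apply: eq_bigr => j _; rewrite inE; case: ifP.
Qed.

Lemma outdeg_le (i : 'I_n) : (outdeg G i <= n.-1)%N.
Proof.
have -> : n.-1 = #|[set~ i]| by rewrite cardsC1 card_ord.
apply: subset_leq_card; apply/subsetP => j; rewrite !inE => ij.
apply: contraTneq ij => ->; apply/negP => /adj_underlying.
by rewrite underlying_irr.
Qed.

Hypothesis tree : mixed_tree G.

Lemma triangle_free (i j k : 'I_n) :
  underlying G i j -> underlying G j k -> underlying G k i -> False.
Proof.
case: tree => _ _ acyc ij jk ki; apply: (acyc [:: i; j; k]) => //.
have ne x y : underlying G x y -> x != y.
  by move=> xy; apply: contraTneq xy => ->; rewrite underlying_irr.
rewrite /ucycle [uniq _]/= !inE negb_or (ne _ _ ij) (ne _ _ jk) eq_sym (ne _ _ ki) [cycle _ _]/=.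
by rewrite ij jk ki.
Qed.

Lemma arc_not_connect (i j : 'I_n) : Defs.arc G i j -> ~~ connect (adj G) j i.
Proof.
case: tree => _ _ acyc ij.
apply: (not_connect_last adj_underlying acyc).
    by rewrite adj_underlying // /adj /= ij.
  by apply: contraTneq ij => ->; apply/negP => aii; have := arc_excl aii; rewrite aii.
by rewrite /adj /= negb_or edge_sym arc_excl.
Qed.

Lemma bicolored_edge : exists f : pred 'I_n, forall i j, edge G i j -> f i != f j.
Proof.
case: tree => _ _ acyc.
have [f fP] := acyclic_bicoloring underlying_sym underlying_irr acyc.
by exists f => i j /edge_underlying; apply: fP.
Qed.

(** A common out-neighbour of [i] and [j] would complete a triangle, so their out-neighbourhoods are
    disjoint. *)
Lemma outdeg_edge (i j : 'I_n) : edge G i j ->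
  [/\ (0 < outdeg G i)%N, (0 < outdeg G j)%N & (outdeg G i + outdeg G j <= n)%N].
Proof.
move=> ij; split.
- by apply/card_gt0P; exists j; rewrite inE edge_adj.
- by apply/card_gt0P; exists i; rewrite inE edge_adj // edge_sym.
rewrite /outdeg -cardsUI [X in (_ + X)%N](_ : _ = 0%N).
  by rewrite addn0; apply: leq_trans (max_card _) _; rewrite card_ord.
apply/eqP; rewrite cards_eq0; apply/eqP/setP => k; rewrite !inE.
apply/negP => /andP[ik jk].
apply: (@triangle_free i j k); first exact: edge_underlying.
  exact: adj_underlying.
by rewrite underlying_sym adj_underlying.
Qed.

Definition n_edges := #|[set p : 'I_n * 'I_n | edge G p.1 p.2 & (p.1 < p.2)%N]|.

Lemma card_bicolored_edges (f : pred 'I_n) :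
  (forall i j, edge G i j -> f i != f j) ->
  #|[set p | edge G p.1 p.2 & f p.1 && ~~ f p.2]| = n_edges.
Proof.
move=> fP; apply/eqP; rewrite -(eqn_pmul2l (ltn0Sn 1)); apply/eqP.
rewrite (@card_oriented_edges _ _ (fun i j => f i && ~~ f j) (edge_sym G)).
  rewrite (@card_oriented_edges _ _ (fun i j : 'I_n => i < j)%N (edge_sym G)) //.
  move=> i j ij; case: ltngtP => // /val_inj eij.
  by rewrite eij edge_irr in ij.
by move=> i j /fP; case: (f i) (f j) => [] [].
Qed.

(** Arcs and edges together number at least [n - 1] by connectedness, and the size counts each edge
    once more. *)
Lemma n_edges_le_size : (n_edges + n <= (mixed_size G).+1)%N.
Proof.
case: tree => n0 conn _.
pose A := [set p : 'I_n * 'I_n | Defs.arc G p.1 p.2].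
pose E := [set p : 'I_n * 'I_n | edge G p.1 p.2 & (p.1 < p.2)%N].
have : (#|'I_n|.-1 <= #|A :|: E|)%N.
  apply: (connected_card_edges _ conn) => i j; rewrite !inE /=.
  rewrite (edge_sym G j i); case/or3P=> [->|->|ij]; rewrite ?orbT // ij /=.
  case: ltngtP; rewrite ?orbT // => /val_inj eij.
  by rewrite eij edge_irr in ij.
rewrite card_ord => /leq_trans/(_ (leq_card_setU A E)) le.
change (#|E| + n <= (#|A| + 2 * #|E|).+1)%N.
by move: #|A| #|E| le => a b le; lia.
Qed.

(** * Mixed trees with a vertex whose out-neighbours are all other vertices *)

Section Star.
Variable c : 'I_n.
Hypothesis centre : forall j, adj G c j = (j != c).

Lemma star_underlying (i j : 'I_n) : i != c -> j != c -> underlying G i j = false.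
Proof.
move=> ic jc; apply/negP => ij; apply: (@triangle_free c i j) => //.
  by rewrite adj_underlying // centre.
by rewrite underlying_sym adj_underlying // centre.
Qed.

(** Two leaves are never adjacent, and an arc from a leaf into [c] would exclude the adjacency from
    [c] to that leaf. *)
Lemma star_arc (i j : 'I_n) : Defs.arc G i j -> i = c.
Proof.
move=> ij; apply/eqP/negPn/negP => ic.
have [jc|jc] := eqVneq j c; last first.
  by have := star_underlying ic jc; rewrite adj_underlying // /adj /= ij.
by have := centre i; rewrite ic -jc /adj /= (edge_sym G) => /orP;
  have /andP[/negbTE -> /negbTE ->] := arc_excl ij; case.
Qed.

Lemma star_adj :
  [/\ outdeg G c = n.-1, forall j, j != c -> outdeg G j = edge G c j
    & forall i j, i != c -> j != c -> edge G i j = false].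
Proof.
have edgeN i j : i != c -> j != c -> edge G i j = false.
  move=> ic jc; apply/negP => /edge_underlying.
  by rewrite star_underlying.
split=> // [|j jc].
  rewrite /outdeg -[n in n.-1]card_ord -(cardsC1 c); apply: eq_card => j.
  by rewrite !inE centre.
rewrite outdegE (bigD1 c) //= big1 => [|k kc].
  rewrite addn0 /adj /= (edge_sym G j).
  suff -> : Defs.arc G j c = false by [].
  by apply/negP => /star_arc/eqP; rewrite (negbTE jc).
rewrite /adj /= edgeN // orbF.
by case jk : (Defs.arc G j k) => //; rewrite (star_arc jk) eqxx in jc.
Qed.

(** The [n - 1] out-neighbours of the centre split into arc heads and edge ends, which turns
    [n_edges_le_size] into an equality. *)
Lemma star_size :
  (mixed_size G).+1 = (n_edges + n)%N /\ n_edges = #|[set j | edge G c j]|.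
Proof.
case: tree => n0 _ _; have [degc _ edgeN] := star_adj.
have inj : injective (pair c : 'I_n -> 'I_n * 'I_n) by move=> i j [].
have edgesE : n_edges = #|[set j | edge G c j]|.
  (* Centre against leaves is a proper 2-colouring, so orienting edges by colour lists them as pairs
     starting at [c]. *)
  rewrite -(@card_bicolored_edges (pred1 c)) => [|i j ij] /=; last first.
    have [ic|ic] := eqVneq i c; have [jc|jc] := eqVneq j c => //.
      by rewrite ic jc edge_irr in ij.
    by rewrite edgeN in ij.
  rewrite -(card_imset _ inj); apply: eq_card => -[i j]; rewrite !inE /=.
  apply/idP/imsetP => [/and3P[ij /eqP ic _]|[k]].
    by exists j; rewrite ?ic // inE -ic.
  rewrite inE => ck [-> ->]; rewrite ck eqxx /=.
  by apply: contraTneq ck => ->; rewrite edge_irr.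
have arcsE : #|[set p : 'I_n * 'I_n | Defs.arc G p.1 p.2]|
    = #|[set j | Defs.arc G c j]|.
  rewrite -(card_imset _ inj); apply: eq_card => -[i j]; rewrite !inE /=.
  apply/idP/imsetP => [ij|[k]]; last by rewrite inE => ck [-> ->].
  by exists j; rewrite -(star_arc ij) ?inE.
split=> //; rewrite /mixed_size -/n_edges arcsE edgesE.
have : (#|[set j | Defs.arc G c j]| + #|[set j | edge G c j]| = n.-1)%N.
  rewrite -degc /outdeg -cardsUI [X in (_ + X)%N](_ : _ = 0%N) ?addn0.
    by apply: eq_card => j; rewrite !inE.
  apply/eqP; rewrite cards_eq0; apply/eqP/setP => j; rewrite !inE.
  by apply/negP => /andP[/arc_excl/andP[_ /negbTE ->]].
by move: #|_| #|_| => a b; lia.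
Qed.

End Star.

Lemma max_outdeg_centre :
  max_outdeg G = n.-1 -> exists c, forall j, adj G c j = (j != c).
Proof.
case: tree => n0 _ _ maxE.
have [|c cE] := @bigop.eq_bigmax _ (outdeg G); first by rewrite card_ord.
exists c; suff /setP eqS : [set j | adj G c j] = [set~ c].
  by move=> j; have := eqS j; rewrite !inE.
apply/eqP; rewrite eqEcard cardsC1 card_ord -maxE /max_outdeg cE leqnn andbT.
apply/subsetP => j; rewrite !inE => cj.
by apply: contraTneq cj => ->; apply/negP => /adj_underlying; rewrite underlying_irr.
Qed.

End MixedTree.

(** * Spectrum of [A_alpha]: existence, upper bound and attainment *)

Section Spectrum.
Variables (R : realType) (n : nat) (G : mixedGraph n) (alpha : R).

(** Only the off-diagonal arc entries are dropped; the out-degrees on the diagonal still count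
    arcs. *)
Definition edge_A_alpha : 'M[R]_n :=
  alpha *: outdeg_mx G R + (1 - alpha) *: \matrix_(i, j) (edge G i j)%:R.

Lemma edge_A_alpha_sym : edge_A_alpha^T = edge_A_alpha.
Proof.
rewrite /edge_A_alpha linearD !linearZ /= tr_diag_mx; congr (_ + _ *: _).
by apply/matrixP => i j; rewrite !mxE edge_sym.
Qed.

Lemma edge_A_alpha_eigenP (r : R) (v : 'rV[R]_n) :
  v *m edge_A_alpha = r *: v <->
  forall j, (r - alpha * (outdeg G j)%:R) * v 0 j
            = (1 - alpha) * \sum_i (edge G i j)%:R * v 0 i.
Proof.
have E j : (v *m edge_A_alpha) 0 j = alpha * (outdeg G j)%:R * v 0 j
    + (1 - alpha) * \sum_i (edge G i j)%:R * v 0 i.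
  rewrite /edge_A_alpha mulmxDr -!scalemxAr mul_mx_diag !mxE; congr (_ + _ * _).
    by ring.
  by apply: eq_bigr => i _; rewrite mxE mulrC.
split=> [/rowP vM j|vM].
  by have := vM j; rewrite E !mxE => H; rewrite mulrBl -H; ring.
by apply/rowP => j; rewrite E -vM !mxE; ring.
Qed.

(* Every arc strictly decreases the number of reachable vertices, which is
   constant along undirected edges. *)
Lemma char_poly_A_alpha :
  mixed_tree G -> char_poly (A_alpha G alpha) = char_poly edge_A_alpha.
Proof.
move=> tree.
pose h i := #|[set k | connect (adj G) i k]|.
have hle i j : adj G i j -> (h j <= h i)%N.
  move=> ij; apply: subset_leq_card; apply/subsetP => k; rewrite !inE.
  exact/connect_trans/connect1.
have hlt i j : Defs.arc G i j -> (h j < h i)%N.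
  move=> ij; apply: proper_card; apply/properP; split.
    apply/subsetP => k; rewrite !inE; apply/connect_trans/connect1.
    by rewrite /adj /= ij.
  by exists i; rewrite !inE ?connect0 // arc_not_connect.
apply: (@det_level_eq _ _ _ _ h) => i j hij; rewrite !mxE /adj /=.
  have -> // : Defs.arc G i j = false.
  by apply/negP => /hlt; rewrite hij ltnn.
have ij : i == j = false by apply/eqP => ij; rewrite ij ltnn in hij.
have -> : Defs.arc G i j = false by apply/negP => /hlt; rewrite ltnNge ltnW.
have -> : edge G i j = false.
  by apply/negP => /edge_adj/hle; rewrite leqNgt hij.
by rewrite ij /= !mulr0n !mulr0 addr0 subr0.
Qed.

Hypothesis tree : mixed_tree G.

Lemma eigenvalue_A_alpha (x : R) :
  eigenvalue (A_alpha G alpha) x = eigenvalue edge_A_alpha x.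
Proof. by rewrite !eigenvalue_root_char char_poly_A_alpha. Qed.

Lemma A_alpha_has_rho : exists r, is_rho G alpha r.
Proof.
have [n0 _ _] := tree.
have [x ex] := symmetric_eigenvalue n0 edge_A_alpha_sym.
have p0 := monic_neq0 (char_poly_monic (A_alpha G alpha)).
have [s sP] : exists s : seq R, forall y, eigenvalue (A_alpha G alpha) y = (y \in s).
  exists (rootsR (char_poly (A_alpha G alpha))) => y.
  by rewrite -roots_on_rootsR // inE eigenvalue_root_char.
have : x \in s by rewrite -sP eigenvalue_A_alpha.
case: s sP => // y s sP _.
exists (\big[Order.max/y]_(z <- y :: s) z); split=> [|z]; rewrite sP.
  rewrite big_seq; elim/big_ind: _ => //; first exact: mem_head.
  by move=> a b a_s b_s; case: leP.
by move=> zs; apply: le_bigmax_seq zs _.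
Qed.

Hypothesis alpha01 : 0 <= alpha <= 1.

Lemma A_alpha_eigenvalue_le (x : R) :
  eigenvalue (A_alpha G alpha) x -> x <= rho_bound alpha n (mixed_size G).
Proof.
have [n0 _ _] := tree.
have le_size := n_edges_le_size tree.
have [a0 a1] := andP alpha01.
have [|rq ar anr] := @rho_bound_quadratic R alpha n (mixed_size G) n0 _ a0.
  by apply: leq_trans le_size; rewrite leq_addl.
rewrite eigenvalue_A_alpha => /eigenvalueP[v /edge_A_alpha_eigenP eig v0].
rewrite leNgt; apply/negP => ltx.
have [f fP] := bicolored_edge tree.
have ax : 0 < x - alpha by lra.
have anx : 0 < x - alpha * (n%:R - 1) by lra.
have n1 : n.-1%:R = n%:R - 1 :> R by case: n n0 => // k _; rewrite -natr1; ring.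
have : (x - alpha) * (x - alpha * (n%:R - 1)) <= (1 - alpha) ^+ 2 *
    #|[set p | edge G p.1 p.2 & f p.1 && ~~ f p.2]|%:R.
  apply: (bicolored_eigenvector_bound (edge_sym G) fP _ _ _ eig).
  - move=> i; have : (outdeg G i)%:R <= n%:R - 1 :> R by rewrite -n1 ler_nat outdeg_le.
    by move=> /(ler_wpM2l a0); lra.
  - exact: mulr_gt0.
  - move=> i j /(outdeg_edge tree)[].
    rewrite -(ler_nat R) => i1; rewrite -(ler_nat R) => j1.
    rewrite -(ler_nat R) natrD => ij.
    (* The left sides of [h1] and [h2] add up to exactly [(x - alpha d_i) (x - alpha d_j) - K]. *)
    have h1 : 0 <= alpha * (x - alpha) * (n%:R - (outdeg G i)%:R - (outdeg G j)%:R).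
      by rewrite !mulr_ge0 //; lra.
    have h2 : 0 <= alpha ^+ 2 * (((outdeg G i)%:R - 1) * ((outdeg G j)%:R - 1)).
      by rewrite mulr_ge0 ?sqr_ge0 // mulr_ge0 //; lra.
    lra.
  - by apply/rV0Pn.
rewrite (card_bicolored_edges fP).
have : (1 - alpha) ^+ 2 * (n_edges G)%:R
    <= (1 - alpha) ^+ 2 * ((mixed_size G)%:R - n%:R + 1).
  rewrite ler_wpM2l ?sqr_ge0 //.
  by move: le_size; rewrite -(ler_nat R) natrD -natr1; lra.
rewrite -rq => le1 le2.
(* At the bound both factors are nonnegative, and both strictly increase on passing to [x]. *)
have : (rho_bound alpha n (mixed_size G) - alpha)
    * (rho_bound alpha n (mixed_size G) - alpha * (n%:R - 1))
    < (x - alpha) * (x - alpha * (n%:R - 1)).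
  by apply: ltr_pM; lra.
lra.
Qed.

(* The vector is [r - alpha] at the centre and [1 - alpha] at the ends of the
   edges; it vanishes only when [r = alpha], where the indicator of the centre
   is an eigenvector. *)
Lemma star_eigenvalue (c : 'I_n) :
  (1 < n)%N -> (forall j, adj G c j = (j != c)) ->
  eigenvalue (A_alpha G alpha) (rho_bound alpha n (mixed_size G)).
Proof.
move=> n1 cP.
have [n0 _ _] := tree.
have [a0 a1] := andP alpha01.
have le_size := n_edges_le_size tree.
have [|rq ar anr] := @rho_bound_quadratic R alpha n (mixed_size G) n0 _ a0.
  by apply: leq_trans le_size; rewrite leq_addl.
have [sizeE edgesE] := star_size tree cP.
have [degc degN edgeN] := star_adj tree cP.
pose e j : R := (edge G c j)%:R.
have uE : \sum_j e j = (n_edges G)%:R.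
  rewrite edgesE -sum1_card natr_sum [RHS]big_mkcond; apply: eq_bigr => j _.
  by rewrite inE /e; case: (edge _ _ _).
move: rq; have -> : (mixed_size G)%:R - n%:R + 1 = (n_edges G)%:R :> R.
  by have := congr1 (fun k => k%:R : R) sizeE; rewrite natrD -natr1 => H; lra.
set r := rho_bound _ _ _ in ar anr * => rq.
have nR : n.-1%:R = n%:R - 1 :> R by case: n n0 => // k _; rewrite -natr1; ring.
have [a [b [a_neq0 eqc eqe]]] : exists a b, [/\ a != 0,
    (r - alpha * (n%:R - 1)) * a = (1 - alpha) * (b * (n_edges G)%:R) &
    forall j, edge G c j -> (r - alpha) * b = (1 - alpha) * a].
  have [ra|ra] := eqVneq r alpha; last first.
    exists (r - alpha), (1 - alpha); split; first by rewrite subr_eq0.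
      by rewrite mulrC rq; ring.
    by move=> j _; rewrite mulrC.
  (* If [r = alpha], then [alpha * (n - 2) <= 0]; as [n >= 2], this forces
     [alpha * (n - 1) = alpha]. For [n = 1] the bound would be [alpha] while the matrix is zero. *)
  exists 1, 0; split; first exact: oner_neq0.
    have n2 : 2 <= n%:R :> R by rewrite ler_nat.
    have : 0 <= alpha * (n%:R - 2) by rewrite mulr_ge0 ?subr_ge0.
    by move: anr; rewrite ra; lra.
  (* The quadratic now says [(1 - alpha)^2] times the number of edges is zero, and the edge [cj]
     leaves only [alpha = 1]. *)
  move=> j cj; rewrite mulr0 mulr1; move/esym/eqP: rq.
  rewrite ra subrr mul0r mulf_eq0 sqrf_eq0 => /orP[/eqP ->//|].
  rewrite pnatr_eq0 edgesE => /eqP/card0_eq/(_ j).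
  by rewrite inE cj.
rewrite eigenvalue_A_alpha; apply/eigenvalueP.
exists (\row_j (if j == c then a else b * e j)); last first.
  by apply/rV0Pn; exists c; rewrite mxE eqxx.
apply/edge_A_alpha_eigenP => j; rewrite mxE.
have [->|jc] := eqVneq j c.
  rewrite degc nR eqc -uE mulr_sumr; congr (_ * _); apply: eq_bigr => i _.
  rewrite mxE edge_sym /e; have [->|_] := eqVneq i c.
    by rewrite edge_irr mulr0 mul0r.
  by case: (edge _ _ _); rewrite ?mulr1 ?mul1r ?mulr0 ?mul0r.
rewrite (bigD1 c) //= mxE eqxx big1 ?addr0 => [|i ic]; last first.
  by rewrite edgeN ?mul0r.
rewrite degN // /e; case cj : (edge G c j); last by rewrite !mulr0 mul0r mulr0.
by rewrite mulr1 mulr1 mul1r (eqe j).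
Qed.

End Spectrum.

Theorem theorem1p1 (R : realType) (alpha : R) (n m : nat)
    (alpha01 : 0 <= alpha <= 1) :
  (forall T : mixedGraph n, mixed_tree T -> mixed_size T = m ->
     exists2 rho : R, is_rho T alpha rho & rho <= rho_bound alpha n m)
  /\
  (forall S : mixedGraph n, (1 < n)%N -> mixed_star S -> mixed_size S = m ->
     max_outdeg S = n.-1 -> is_rho S alpha (rho_bound alpha n m)).
Proof.
split=> [T tree <-|S n1 [tree _] <- maxE].
  have [rho rhoP] := A_alpha_has_rho alpha tree.
  by exists rho => //; apply: A_alpha_eigenvalue_le => //; case: rhoP.
have [c cP] := max_outdeg_centre tree maxE.
split; first exact: star_eigenvalue cP.
by move=> x; apply: A_alpha_eigenvalue_le.
Qed.
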